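(* Let $K$ be an infinite compact Hausdorff scattered space. Then $m(C(K))=\omega$.
   Context: A topological space is scattered if every nonempty subspace has a (relatively) isolated point. $C(K)$ is the Banach space of continuous real functions on $K$ with the supremum norm. A subset $S$ of a metric space $(M,d)$ is equilateral if there is $\lambda>0$ with $d(x,y)=\lambda$ for all distinct $x,y\in S$. An equilateral set $A\subseteq M$ is maximal if there is no equilateral set $B\subseteq M$ with $A\subsetneq B$. $m(M)=\min\{|A|: A \text{ is a maximal equilateral set in } M\}$ (a cardinal). A normed space is regarded as a metric space via its norm. *)

(* Defs.v *)
From HB Require Import structures.
From mathcomp Require Import all_boot all_order all_algebra.
From mathcomp Require Import all_classical all_reals all_analysis.

Set Implicit Arguments.
Unset Strict Implicit.
Unset Printing Implicit Defensive.

Import Order.TTheory GRing.Theory Num.Theory.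
Import numFieldNormedType.Exports.

Local Open Scope classical_set_scope.
Local Open Scope ring_scope.

Definition scattered (K : topologicalType) : Prop :=
  forall A : set K, A !=set0 -> isolated A !=set0.

Definition equilateral (R : realType) (M : metricType R) (S : set M) : Prop :=
  exists2 lambda : R, 0 < lambda &
    forall x y, S x -> S y -> x <> y -> mdist x y = lambda.

Definition maximal_equilateral (R : realType) (M : metricType R)
    (A : set M) : Prop :=
  equilateral A /\ ~ (exists B : set M, equilateral B /\ A `<` B).

(* Cardinals have no type of their own in the library: [m_is M X] says that
   the least cardinality m(M) of a maximal equilateral subset of M, a minimum
   and hence attained, is the cardinality of the set X. *)
Definition m_is (R : realType) (M : metricType R) (T : Type) (X : set T) :
    Prop :=
  (exists2 A : set M, maximal_equilateral A & (A #= X)%card) /\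
  (forall A : set M, maximal_equilateral A -> (X #<= A)%card).

(* The compactness proof is a parameter of the type because the algebraic
   structure does not need it but the supremum norm does. *)
Definition Cspace (R : realType) (K : topologicalType) (cK : compact [set: K]) :
  Type := continuousType K R.

Section C_structure.
Context (R : realType) (K : topologicalType) (cK : compact [set: K]).
Local Notation CK := (Cspace R cK).
Implicit Types (f g h : CK) (a b : R).

HB.instance Definition _ := Choice.on CK.

Definition C_fun (f : CK) : K -> R := f : continuousType K R.

Lemma C_eqP f g : (forall x, C_fun f x = C_fun g x) -> f = g.
Proof. by move=> fg; apply/continuousEP => x; exact: fg. Qed.

Lemma C_continuous f : continuous (C_fun f).
Proof. exact: cts_fun. Qed.

Let add_cont f g : continuous (fun x => C_fun f x + C_fun g x).
Proof. by move=> x; apply: cvgD; exact: C_continuous. Qed.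

Let opp_cont f : continuous (fun x => - C_fun f x).
Proof. by move=> x; apply: cvgN; exact: C_continuous. Qed.

Let scale_cont a f : continuous (fun x => a * C_fun f x).
Proof. by move=> x; apply: cvgMl_tmp; exact: C_continuous. Qed.

Let zero_cont : continuous (fun _ : K => 0 : R).
Proof. by move=> x; exact: cvg_cst. Qed.

Definition C_zero : CK := mkcts zero_cont : continuousType K R.
Definition C_opp f : CK := mkcts (@opp_cont f) : continuousType K R.
Definition C_add f g : CK := mkcts (@add_cont f g) : continuousType K R.
Definition C_scale a f : CK := mkcts (@scale_cont a f) : continuousType K R.

Let addA : associative C_add.
Proof. by move=> f g h; apply: C_eqP => x; exact: addrA. Qed.

Let addC : commutative C_add.
Proof. by move=> f g; apply: C_eqP => x; exact: addrC. Qed.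

Let add0 : left_id C_zero C_add.
Proof. by move=> f; apply: C_eqP => x; exact: add0r. Qed.

Let addN : left_inverse C_zero C_opp C_add.
Proof. by move=> f; apply: C_eqP => x; exact: addNr. Qed.

HB.instance Definition _ := GRing.isZmodule.Build CK addA addC add0 addN.

Let scaleA a b f : C_scale a (C_scale b f) = C_scale (a * b) f.
Proof. by apply: C_eqP => x; exact: mulrA. Qed.

Let scale1 : left_id 1 C_scale.
Proof. by move=> f; apply: C_eqP => x; exact: mul1r. Qed.

Let scaleDr : right_distributive C_scale +%R.
Proof. by move=> a f g; apply: C_eqP => x; exact: mulrDr. Qed.

Let scaleDl f : {morph C_scale^~ f : a b / a + b}.
Proof. by move=> a b; apply: C_eqP => x; exact: mulrDl. Qed.

HB.instance Definition _ := GRing.Zmodule_isLmodule.Build R CK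
  scaleA scale1 scaleDr scaleDl.

(* This is 0 when K is empty, because [sup set0 = 0]. *)
Definition sup_norm f : R := sup [set `|C_fun f x| | x in [set: K]].

Lemma sup_norm_ub f x : `|C_fun f x| <= sup_norm f.
Proof.
have /compact_has_sup hs : compact [set `|C_fun f x| | x in [set: K]].
  apply: continuous_compact => //; apply: continuous_subspaceT => y.
  by apply: cvg_norm; exact: C_continuous.
apply: ub_le_sup; last by exists x.
by apply: (proj2 (hs _)); exists `|C_fun f x|, x.
Qed.

Lemma sup_norm_le f a : 0 <= a -> (forall x, `|C_fun f x| <= a) ->
  sup_norm f <= a.
Proof.
move=> a0 fa; rewrite /sup_norm.
have [->|/set0P ne] := eqVneq [set `|C_fun f x| | x in [set: K]] set0.
  by rewrite sup0.
by apply: ge_sup => // y [x _ <-]; exact: fa.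
Qed.

Lemma sup_norm_ge0 f : 0 <= sup_norm f.
Proof.
have [[x _]|K0] := pselect (exists x : K, True).
  exact: le_trans (sup_norm_ub f x).
rewrite /sup_norm (_ : [set _ | _ in _] = set0) ?sup0//.
by apply/seteqP; split => // y [x _ _]; apply: K0; exists x.
Qed.

Let normD f g : sup_norm (f + g) <= sup_norm f + sup_norm g.
Proof.
apply: sup_norm_le => [|x]; first by rewrite addr_ge0// sup_norm_ge0.
by apply: le_trans (ler_normD _ _) _; apply: lerD; exact: sup_norm_ub.
Qed.

Let normZ a f : sup_norm (a *: f) = `|a| * sup_norm f.
Proof.
have le b h : sup_norm (b *: h) <= `|b| * sup_norm h.
  apply: sup_norm_le => [|x]; first by rewrite mulr_ge0// sup_norm_ge0.
  by rewrite [X in `|X|](_ : _ = b * C_fun h x)// normrM ler_wpM2l// sup_norm_ub.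
apply/eqP; rewrite eq_le le/=.
have [->|a0] := eqVneq a 0; first by rewrite normr0 mul0r sup_norm_ge0.
rewrite mulrC -ler_pdivlMr ?normr_gt0// mulrC -normfV.
by apply: le_trans (le a^-1 (a *: f)); rewrite scalerA mulVf// scale1r.
Qed.

Let norm_eq0 f : sup_norm f = 0 -> f = 0.
Proof.
move=> f0; apply: C_eqP => x; apply/normr0_eq0/eqP.
by rewrite eq_le normr_ge0 andbT -f0 sup_norm_ub.
Qed.

HB.instance Definition _ :=
  Lmodule_isNormed.Build R CK normD normZ norm_eq0.

Let dist f g := `|f - g|.

Let dist_ge0 f g : 0 <= dist f g. Proof. exact: normr_ge0. Qed.

Let dist_positivity f g : dist f g = 0 -> f = g.
Proof. by move/normr0_eq0/eqP; rewrite subr_eq0 => /eqP. Qed.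

Let ball_dist f a : ball f a = [set g | dist f g < a].
Proof. by rewrite -ball_normE. Qed.

HB.instance Definition _ :=
  PseudoMetric_isMetric.Build R CK dist_ge0 dist_positivity ball_dist.

End C_structure.

(* Main.v *)
(* In a compact scattered space a point that is isolated among the
   non-isolated points is the limit of a sequence x_0, x_1, ... of distinct
   isolated points, and everything happens along such a sequence.

   A finite equilateral set A with distance l is never maximal: pick for each
   pair of its members a point where they differ by l, then an isolated point c
   which is none of these, and raise the member of A that is smallest at c by l
   at the single point c.

   A countable maximal equilateral set (with distance 2) consists of the
   functions f_n with f_n(x_k) = (-1)^k for k < n, f_n(x_n) = -(-1)^n and
   f_n = (-1)^n (1 - 1/(n+1)) elsewhere. A function g at distance 2 from all of
   them satisfies |g| <= 1, so the distance 2 to f_n is attained at one of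
   x_0, ..., x_n; by induction this forces g(x_n) = (-1)^n for all n,
   contradicting the convergence of g(x_n). *)

Require Import Defs.
From mathcomp Require Import all_boot all_order all_algebra.
From mathcomp Require Import all_classical all_reals all_analysis.
From mathcomp Require Import lra.

Set Implicit Arguments.
Unset Strict Implicit.
Unset Printing Implicit Defensive.

Import Order.TTheory GRing.Theory Num.Theory.
Import numFieldNormedType.Exports.

Local Open Scope classical_set_scope.
Local Open Scope ring_scope.

(** * Sequences of isolated points in compact scattered spaces *)

Lemma cluster_injective_not_open (T : topologicalType) (x : nat -> T) (q : T) :
  injective x -> cluster (x @ \oo) q -> ~ open [set q].
Proof.
move=> xI xq oq.
(* An injective sequence meets [q] at most once, so a tail of it avoids [q]. *)
have [y []] : [set z | z <> q] `&` [set q] !=set0.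
  apply: xq; last by apply: open_nbhs_nbhs; split.
  have [[m xm]|nx] := pselect (exists m, x m = q).
    exists m.+1 => // n /= mn xn.
    by move: mn; rewrite (xI n m) ?ltnn// xn xm.
  by exists 0%N => // n _ xn; apply: nx; exists n.
by [].
Qed.

Lemma infinite_injection (T : Type) (A : set T) : infinite_set A ->
  exists2 x : nat -> T, injective x & forall n, A (x n).
Proof.
move=> /infiniteP/card_leP[f].
have nT (n : nat) : n \in [set: nat] by rewrite inE.
exists (fun n => set_val (f (SigSub (nT n)))) => [m n fmn|n]; last first.
  exact: set_valP.
have : f (SigSub (nT m)) = f (SigSub (nT n)) by exact: val_inj.
by move/inj => mn; have [] := mn (mem_set I) (mem_set I).
Qed.

Lemma compact_infinite_not_open1 (T : topologicalType) :
  compact [set: T] -> infinite_set [set: T] -> exists q : T, ~ open [set q].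
Proof.
move=> cT /infinite_injection[x xI _].
have [q [_ xq]] := cT (x @ \oo) _ filterT.
by exists q; exact: cluster_injective_not_open xq.
Qed.

(** Near a point isolated among the non-isolated ones, an injective sequence can cluster at no other
    point, and compactness turns a unique cluster point into a limit. *)
Lemma scattered_cvg_sequence (K : topologicalType) :
  compact [set: K] -> hausdorff_space K -> scattered K ->
  infinite_set [set: K] ->
  exists (x : nat -> K) (p : K),
    [/\ injective x, forall n, open [set x n] & x @ \oo --> p].
Proof.
move=> cK hK sK iK.
have T1 := hausdorff_accessible hK.
pose D := [set y : K | open [set y]].
have [p [/set_mem Dp [V Vp VD]]] : isolated (~` D) !=set0.
  by apply: sK; exact: compact_infinite_not_open1.
have [W Wp WV] : filter_from (nbhs p) closure V.
  exact: (compact_regular hK cK filterT).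
have WD y : closure W y -> y <> p -> open [set y].
  move=> Wy yp; apply: contrapT => Dy; apply: yp.
  by have : (V `&` ~` D) y; [split => //; exact: WV|rewrite VD].
have [x xI xW] : exists2 x : nat -> K, injective x &
    forall n, (W `\` [set p]) (x n).
  (* Were [W] without [p] finite, it would be closed, and removing it from [W] would show [p]
     isolated. *)
  apply: infinite_injection => fW; apply: Dp.
  have cW : closed (W `\` [set p]).
    by have /accessible_finite_set_closed := T1; apply.
  rewrite /D/= openE => y /= ->; rewrite /interior.
  have : nbhs p (~` (W `\` [set p])).
    by apply: open_nbhs_nbhs; split; [exact: closed_openC|move=> -[_ /=]].
  apply: filterS2 Wp => z Wz nz; apply: contrapT => zp.
  exact: nz.
exists x, p; split=> // [n|].
  by have [Wx xp] := xW n; apply: WD => //; exact: subset_closure.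
apply: (compact_cluster_set1 hK cK) => //; try exact: filterT.
have sub : cluster (x @ \oo) `<=` [set p].
  move=> q xq; apply: contrapT => qp.
  apply: (cluster_injective_not_open xI xq); apply: WD => // U Uq.
  have : (x @ \oo) W by exists 0%N => // n _; exact: (xW n).1.
  by move=> xWn; exact: xq.
apply/seteqP; split=> // _ ->.
have [q [_ xq]] := cK (x @ \oo) _ filterT.
by rewrite -(sub q xq).
Qed.

(** * Continuous functions and the distances between them *)

Lemma continuous_finite_modification (T U : topologicalType) (E : set T)
    (g h : T -> U) :
  accessible_space T -> finite_set E -> (forall y, E y -> open [set y]) ->
  (forall y, ~ E y -> h y = g y) -> continuous g -> continuous h.
Proof.
move=> T1 fE oE hg cg y.
have [Ey|nEy] := pselect (E y).
  apply: cvg_near_cst; apply: filterS (_ : nbhs y [set y]).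
    by move=> z ->.
  by apply: open_nbhs_nbhs; split => //; exact: oE.
rewrite /continuous_at hg//; apply: cvg_trans (cg y); apply: near_eq_cvg.
have /accessible_finite_set_closed/(_ _ fE) cE := T1.
apply: filterS (_ : nbhs y (~` E)); first by move=> z /hg.
by apply: open_nbhs_nbhs; split => //; exact: closed_openC.
Qed.

Section maximal_equilateral_sets.
Context (R : realType) (K : topologicalType) (cK : compact [set: K]).
Local Notation CK := (Cspace R cK).

(** By compactness the supremum is attained; [x0] ensures that there is a point to attain it at. *)
Lemma C_distP (x0 : K) (f g : CK) (a : R) : mdist f g = a <->
  (forall y, `|C_fun f y - C_fun g y| <= a) /\
  exists y, `|C_fun f y - C_fun g y| = a.
Proof.
have [y0 _ y0P] : exists2 c, c \in [set: K] & forall t, t \in [set: K] ->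
    `|C_fun f t - C_fun g t| <= `|C_fun f c - C_fun g c|.
  apply: compact_EVT_max => //; first by exists x0.
  apply: continuous_subspaceT => y; apply: cvg_norm.
  by apply: cvgB; exact: C_continuous.
have le y : `|C_fun f y - C_fun g y| <= mdist f g.
  exact: (sup_norm_ub (f - g)).
have {}y0P : `|C_fun f y0 - C_fun g y0| = mdist f g.
  apply/eqP; rewrite eq_le le/=; apply: sup_norm_le => // y.
  by apply: y0P; rewrite inE.
split=> [<-|[lea [y ya]]]; first by split=> //; exists y0.
by apply/eqP; rewrite eq_le -{1}y0P lea -ya le.
Qed.

Context (T1 : accessible_space K) (x : nat -> K) (xI : injective x)
  (xo : forall n, open [set x n]).

(** * Extending finite equilateral sets *)

Lemma finite_not_maximal_equilateral (A : set CK) :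
  finite_set A -> ~ maximal_equilateral A.
Proof.
move=> fA [[l l0 Al]]; apply.
(* A minimum over [A] is taken below, so the empty set is treated apart: any singleton extends
   it. *)
have [->|/set0P A0] := eqVneq A set0.
  exists [set 0]; split; first by exists 1 => // f g -> ->.
  by split=> // /(_ 0); exact.
(* A function that agrees with [j] at the points [w (i, j)] stays at distance at least [l] from
   every other [i]. *)
have /choice[w wP] (fg : CK * CK) : exists y, A fg.1 -> A fg.2 ->
    fg.1 <> fg.2 -> `|C_fun fg.1 y - C_fun fg.2 y| = l.
  have [[Af [Ag fg']]|n] := pselect (A fg.1 /\ A fg.2 /\ fg.1 <> fg.2).
    by have /(C_distP (x 0%N))[_ [y]] := Al _ _ Af Ag fg'; exists y.
  by exists (x 0%N) => *; exfalso; apply: n.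
have [c [[n _ cE] wc]] : (range x `\` w @` (A `*` A)) !=set0.
  apply: infinite_setN0; apply: infinite_setD.
    apply/infiniteP.
    rewrite -(card_le_eql (inj_card_eq (f := x) (A := setT) _))//.
    exact: in2W.
  by apply: finite_image; exact: finite_setX.
have co : open [set c] by rewrite -cE.
have [j Aj jmin] : exists2 j : CK, A j &
    forall i : CK, A i -> C_fun j c <= C_fun i c.
  have [|||r /set_mem[j Aj <-] rmin] :=
    @compact_EVT_min R R id ((fun i : CK => C_fun i c) @` A).
  - exact: image_nonempty.
  - by apply: finite_compact; exact: finite_image.
  - by apply: continuous_subspaceT => ?; exact: cvg_id.
  - by exists j => // i Ai; apply: rmin; rewrite inE; exists i.
pose h y := if y == c then C_fun j c + l else C_fun j y.
have hc : continuous h.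
  apply: (@continuous_finite_modification _ _ [set c] (C_fun j)) => //.
  - by move=> y ->.
  - by move=> y /eqP/negPf yc; rewrite /h yc.
  - exact: C_continuous.
pose f : CK := mkcts hc : continuousType K R.
have fE y : C_fun f y = h y by [].
have Alf i : A i -> mdist i f = l.
  move=> Ai; apply/(C_distP (x 0%N)).
  have [->|/eqP ij] := eqVneq i j.
    split=> [y|]; last first.
      by exists c; rewrite fE /h eqxx opprD addNKr normrN gtr0_norm.
    rewrite fE /h; case: eqP => [->|_]; last by rewrite subrr normr0 ltW.
    by rewrite opprD addNKr normrN gtr0_norm.
  have /(C_distP (x 0%N))[ijl _] := Al _ _ Ai Aj ij.
  split=> [y|].
    rewrite fE /h; case: eqP => [->|_] //.
    (* Minimality puts the value of [i] at [c] between the old and the raised value of [j], which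
       are [l] apart. *)
    have := ijl c; have := jmin _ Ai; rewrite !ler_norml => *; lra.
  exists (w (i, j)); rewrite fE /h; case: eqP => [wE|_].
    by exfalso; apply: wc; exists (i, j).
  exact: (wP (i, j)).
exists (A `|` [set f]); split.
  exists l => // g g' [Ag|->] [Ag'|->] gg' //; first exact: Al.
  - exact: Alf.
  - by rewrite metric_sym Alf.
split=> [i Ai|/(_ f)]; first by left.
move=> /(_ (or_intror erefl)) /Alf /(C_distP (x 0%N))[_ [y]].
by rewrite subrr normr0 => l0E; rewrite -l0E ltxx in l0.
Qed.

(** * A countable maximal equilateral set *)

Local Notation eps n := ((-1) ^+ n : R).

Let eps_cases n : eps n = 1 \/ eps n = -1.
Proof. by rewrite -signr_odd; case: odd; [right|left]. Qed.

(** Modulus below 1 prevents distance 2 from being attained off [x 0], ..., [x n]; approaching both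
    1 and -1 as [n] grows forces the bound 1 on a function at distance 2 from all [f n]. *)
Definition oscillation (n : nat) : R := eps n * (1 - n.+1%:R^-1).

Let inv_le1 n : n.+1%:R^-1 <= 1 :> R.
Proof. by rewrite invf_le1 ?ltr0n// ler1n. Qed.

Let oscillation_lt1 n : `|oscillation n| < 1.
Proof.
by rewrite normrM normrX normrN1 expr1n mul1r ger0_norm ?subr_ge0//.
Qed.

Lemma alternating_function_exists (n : nat) : exists f : CK,
  [/\ forall k, (k < n)%N -> C_fun f (x k) = eps k,
      C_fun f (x n) = - eps n &
      forall y, (forall k, (k <= n)%N -> y <> x k) ->
        C_fun f y = oscillation n].
Proof.
pose h y := if pselect (exists2 k, (k <= n)%N & y = x k) is left e
  then let k := s2val (cid2 e) in if (k < n)%N then eps k else - eps k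
  else oscillation n.
have hx k : (k <= n)%N -> h (x k) = if (k < n)%N then eps k else - eps k.
  move=> kn; rewrite /h; case: pselect => [e|[]]; last by exists k.
  by case: (cid2 e) => m /= mn /xI ->.
have hnx y : (forall k, (k <= n)%N -> y <> x k) -> h y = oscillation n.
  move=> nyx; rewrite /h; case: pselect => // e.
  by exfalso; case: e => k kn; exact: nyx.
have hc : continuous h.
  apply: (@continuous_finite_modification _ _ (x @` `I_n.+1)
    (fun=> oscillation n)) => //.
  - exact/finite_image/finite_II.
  - by move=> _ [k _ <-].
  - by move=> y nyx; apply: hnx => k kn yx; apply: nyx; exists k.
  - by move=> y; exact: cvg_cst.
exists (mkcts hc : continuousType K R); split=> [k kn||//].
- by rewrite [LHS](hx k) ?kn// ltnW.
- by rewrite [LHS](hx n) ?ltnn.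
Qed.

Lemma countable_maximal_equilateral (p : K) : x @ \oo --> p ->
  exists2 A : set CK, maximal_equilateral A & (A #= [set: nat])%card.
Proof.
move=> xp; have /choice[f fP] := alternating_function_exists.
have f1 n y : `|C_fun (f n) y| <= 1.
  have [fl fn fo] := fP n.
  have [[k kn ->]|nyx] := pselect (exists2 k, (k <= n)%N & y = x k).
    move: kn; rewrite leq_eqVlt => /predU1P[->|/fl ->]; rewrite ?fn ?normrN.
      by rewrite normrX normrN1 expr1n.
    by rewrite normrX normrN1 expr1n.
  by rewrite fo ?ltW// => k kn yx; apply: nyx; exists k.
have fd n m : (n < m)%N -> mdist (f n) (f m) = 2.
  move=> nm; apply/(C_distP (x 0%N)); split=> [y|].
    have := f1 n y; have := f1 m y; rewrite !ler_norml => *; lra.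
  (* At [x n] the earlier function is [- eps n] and the later one is [eps n]. *)
  exists (x n); have [_ -> _] := fP n; have [fm _ _] := fP m; rewrite fm//.
  by case: (eps_cases n) => ->; rewrite ?opprK -?opprD ?normrN ger0_norm.
have fd' n m : n <> m -> mdist (f n) (f m) = 2.
  by move=> /eqP; rewrite neq_ltn => /orP[|] /fd //; rewrite metric_sym.
have fI : injective f.
  move=> n m nm; apply: contrapT => /fd'.
  by rewrite nm mdistxx => /eqP; rewrite eq_sym pnatr_eq0.
exists (range f); last by apply: inj_card_eq; exact: in2W.
split.
  exists 2 => // _ _ [n _ <-] [m _ <-] nm; apply: fd' => nmE.
  by apply: nm; rewrite nmE.
move=> [B [[l l0 Bl] [fB BA]]].
have [g Bg ng] : exists2 g, B g & ~ range f g.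
  apply: contrapT => nBA; apply: BA => g Bg; apply: contrapT => ng.
  by apply: nBA; exists g.
have l2 : l = 2.
  rewrite -(@fd' 0%N 1%N)//; apply/esym/Bl; try (by apply: fB; eexists).
  by move/fI.
have gfar n : mdist (f n) g = 2.
  rewrite -l2; apply: Bl => //; first by apply: fB; exists n.
  by move=> fg; apply: ng; exists n.
have gle n y : `|C_fun (f n) y - C_fun g y| <= 2.
  by have /(C_distP (x 0%N))[] := gfar n.
have g1 y : `|C_fun g y| <= 1.
  have [[k ->]|nyx] := pselect (exists k, y = x k).
    (* Here [f k] and [f k.+1] take the values 1 and -1 in some order, and [g] is within 2 of
       both. *)
    have := gle k (x k); have := gle k.+1 (x k).
    have [_ -> _] := fP k; have [fk _ _] := fP k.+1; rewrite fk//.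
    by rewrite !ler_norml; case: (eps_cases k) => -> *; lra.
  have gy n : `|oscillation n - C_fun g y| <= 2.
    have [_ _ fo] := fP n; rewrite -(fo y); first exact: gle.
    by move=> k _ yx; apply: nyx; exists k.
  (* The values of [oscillation] accumulate at both 1 and -1. *)
  rewrite leNgt; apply/negP => /ltr_add_invr[k]; apply/negP; rewrite -leNgt.
  have mono n : (k <= n)%N -> n.+1%:R^-1 <= k.+1%:R^-1 :> R.
    by move=> kn; rewrite lef_pV2 ?posrE ?ltr0n// ler_nat.
  have k2 : (k <= k.*2)%N by rewrite -addnn leq_addr.
  have := gy k.*2; have := gy k.*2.+1; rewrite /oscillation.
  rewrite -!(signr_odd _ (_.*2)) -(signr_odd _ (_.*2).+1) /= odd_double/=.
  rewrite expr0 expr1.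
  have := mono _ k2; have := mono _ (leqW k2).
  move: (k.*2.+2%:R^-1) (k.*2.+1%:R^-1) (k.+1%:R^-1) => a b c.
  by rewrite !ler_norml => *; lra.
have gx n : C_fun g (x n) = eps n.
  elim/ltn_ind: n => n IHn.
  have /(C_distP (x 0%N))[_ [y]] := gfar n; have [fl fn fo] := fP n.
  have [[k kn ->]|nyx] := pselect (exists2 k, (k <= n)%N & y = x k); last first.
    rewrite fo; last by move=> k kn yx; apply: nyx; exists k.
    have := oscillation_lt1 n; have := g1 y.
    rewrite ler_norml ltr_norml => gy oy dE.
    suff : `|oscillation n - C_fun g y| < 2 by rewrite dE ltxx.
    by rewrite ltr_norml; lra.
  move: kn; rewrite leq_eqVlt => /predU1P[->|kn].
    (* The only point of [-1, 1] at distance 2 from [- eps n] is [eps n]. *)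
    rewrite fn; have := g1 (x n); rewrite ler_norml => gn.
    case: (eps_cases n) => ->; last rewrite opprK.
      by rewrite ler0_norm; lra.
    by rewrite ger0_norm; lra.
  (* At an earlier [x k] the functions [f n] and [g] agree by induction, so distance 2 is not
     attained there. *)
  by rewrite fl// IHn// subrr normr0 => /esym/eqP; rewrite pnatr_eq0.
have : C_fun g \o x @ \oo --> C_fun g p.
  by apply: cvg_comp xp _; exact: C_continuous.
move=> /cvgrPdist_lt/(_ 1 ltr01)[N _ Np].
(* Consecutive values are 1 and -1, and no limit is at distance less than 1 from both. *)
have := Np N (leqnn N); have := Np N.+1 (leqnSn N).
rewrite /= !gx exprS !ltr_norml.
by case: (eps_cases N) => ->; lra.
Qed.

End maximal_equilateral_sets.

Theorem corollary4 (R : realType) (K : topologicalType)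
    (K_compact : compact [set: K]%classic)
    (K_hausdorff : hausdorff_space K)
    (K_scattered : scattered K)
    (K_infinite : infinite_set [set: K]%classic) :
  m_is (Cspace R K_compact) [set: nat]%classic.
Proof.
have [x [p [xI xo xp]]] :=
  scattered_cvg_sequence K_compact K_hausdorff K_scattered K_infinite.
have T1 := hausdorff_accessible K_hausdorff.
split=> [|A mA]; first exact: countable_maximal_equilateral xp.
by apply/infiniteP => /(finite_not_maximal_equilateral T1 xI xo); exact.
Qed.
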